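(* Let $P_0,P_1$ be probability measures on a measurable space $(\mathcal X,\mathcal B_{\mathcal X})$ with $P_1\ll P_0$ and $\mathrm{KL}(P_1\|P_0)<\infty$. Let $X_1,X_2,\dots$ be the coordinates on $\Omega=\mathcal X^{\mathbb N}$ and $\mathbb P_1=P_1^{\otimes\mathbb N}$. Let $E:\mathcal X\to[0,\infty]$ be measurable with $\mathbb E_{P_0}[E]\le1$ and $\mathbb E_{P_1}[\log E]>0$, and let $W_t=\prod_{n\le t}E(X_n)$ for $t\in\mathbb N_0$ (so $W_0=1$). Then for every $\alpha\in(0,1)$, the rejection time $\tau_\alpha:=\inf\{t\in\mathbb N:W_t>\frac1\alpha\}$ (with $\inf\emptyset=\infty$) satisfies $\tau_\alpha<\infty$ $\mathbb P_1$-a.s.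
   Context: $\mathbb N=\{1,2,\dots\}$. Conventions: $\log0=-\infty$, $0\cdot\infty=0$. Under the hypotheses $P_1\ll P_0$, $\mathrm{KL}(P_1\|P_0)<\infty$ and $\mathbb E_{P_0}[E]\le1$, the positive part of $\log E$ is $P_1$-integrable, so $\mathbb E_{P_1}[\log E]\in[-\infty,\infty)$ is well defined. *)

(* Defs.v *)
From HB Require Import structures.
From mathcomp Require Import all_boot all_order all_algebra.
From mathcomp Require Import all_classical all_reals all_analysis measurable_realfun numfun.
Set Implicit Arguments. Unset Strict Implicit. Unset Printing Implicit Defensive.
Import Order.TTheory GRing.Theory Num.Theory.
Import numFieldNormedType.Exports.
Local Open Scope classical_set_scope.
Local Open Scope ring_scope.
Local Open Scope ereal_scope.

(* The product space (nat -> T) with the product sigma-algebra and the infinite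
   product measure P^{(x) nat}.  The measure is obtained from the library's
   extension theorem, applied to the semiring of measurable boxes
   prod_i A_i with A_i = T for all but finitely many i; iid_measureE below gives
   its defining values on boxes. *)
Section infinite_product.
Context d (T : measurableType d).
Implicit Types (A B : nat -> set T) (C : set (nat -> T)).

Definition box A : set (nat -> T) := [set w | forall i, A i (w i)].

Definition is_box C A N := [/\ forall i, measurable (A i),
  forall i, (N <= i)%N -> A i = setT & C = box A].

Definition cylinder : set (set (nat -> T)) :=
  [set C | exists A N, is_box C A N].

Local Lemma box0 : box (fun i => if i == 0%N then set0 else setT) = set0.
Proof. by rewrite -subset0 => w /(_ 0%N). Qed.

Local Lemma cylinder0 : cylinder set0.
Proof.
exists (fun i => if i == 0%N then set0 else setT), 1%N; split => [[|i]|[|i]|] //=.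
by rewrite box0.
Qed.

Local Lemma cylinderI : setI_closed cylinder.
Proof.
move=> _ _ [A [N [mA AN ->]]] [B [M [mB BM ->]]].
exists (fun i => A i `&` B i), (maxn N M); split.
- by move=> i; exact: measurableI.
- by move=> i; rewrite geq_max => /andP[Ni Mi]; rewrite AN// BM// setTI.
- rewrite predeqE => w; split=> [[Aw Bw] i|ABw]; first by split.
  by split=> i; have [] := ABw i.
Qed.

Local Lemma cylinderD : semi_setD_closed cylinder.
Proof.
move=> _ _ [A [N [mA AN ->]]] [B [M [mB BM ->]]].
pose D i j := if (j < i)%N then A j `&` B j
              else if j == i then A j `\` B j else A j.
exists [set box (D i) | i in `I_M]; split.
- by apply: finite_image; exact: finite_II.
- move=> _ [i /= iM <-]; exists (D i), (maxn N M); split=> //.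
  + move=> j; rewrite /D; case: ifPn => _; first exact: measurableI.
    by case: ifPn => _ //; exact: measurableD.
  + move=> j; rewrite geq_max => /andP[Nj Mj]; rewrite /D.
    have ij : (i < j)%N by exact: leq_trans Mj.
    by rewrite ltnNge (ltnW ij)/= gtn_eqF// AN.
- rewrite predeqE => w; split.
  + move=> [Aw] /existsNP Bw.
    have Bw' : exists i, `[< ~ B i (w i) >].
      by case: Bw => i Bi; exists i; exact/asboolP.
    case: (ex_minnP Bw') => i /asboolP Bi imin.
    exists (box (D i)).
      exists i => //=; rewrite ltnNge; apply/negP => Mi.
      by apply: Bi; rewrite BM.
    move=> j; rewrite /D; case: ifPn => [ji|_].
      split=> //; apply: contrapT => Bj.
      by have := imin j; rewrite leqNgt ji => /(_ (introT (asboolP _) Bj)).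
    by case: ifPn => [/eqP ->|_].
  + move=> [_ [i iM <-] Dw]; split=> [j|Bw].
      by have := Dw j; rewrite /D; case: ifPn => [_ []|_]//; case: ifPn => [_ []|_].
    by have := Dw i; rewrite /D ltnn eqxx => -[_]; apply; exact: Bw.
- move=> _ _ [i iM <-] [j jM <-] [w [Diw Djw]].
  have [ij|ji|-> //] := ltngtP i j; exfalso.
  + have := Djw i; rewrite /D ij => -[_ Bi].
    by have := Diw i; rewrite /D ltnn eqxx => -[].
  + have := Diw j; rewrite /D ji => -[_ Bj].
    by have := Djw j; rewrite /D ltnn eqxx => -[].
Qed.

(* boxes is (nat -> T) equipped with the semiring of cylinders; path_space below
   carries the sigma-algebra generated by it. *)
Definition box_display : measure_display.
Proof. exact: d. Qed.

Definition boxes := (nat -> T).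
HB.instance Definition _ := Pointed.on boxes.
HB.instance Definition _ := isSemiRingOfSets.Build box_display boxes
  cylinder0 cylinderI cylinderD.

Context (R : realType) (P : probability T R).

Let tl A N n : \bar R := \prod_(n <= i < N) P (A i).
Let hd A (s : seq T) : R := (\prod_(i < size s) \1_(A i) (nth point s i))%R.

Local Lemma tl_ge0 A N n : 0 <= tl A N n.
Proof. by apply: prode_ge0. Qed.

Local Lemma hd_ge0 A s : (0 <= hd A s)%R.
Proof. by apply: prodr_ge0 => i _; rewrite indicE. Qed.

#[local] Hint Resolve tl_ge0 hd_ge0 : core.

Local Lemma hd_rcons A s x : hd A (rcons s x) = (hd A s * \1_(A (size s)) x)%R.
Proof.
rewrite /hd size_rcons big_ord_recr/= nth_rcons ltnn eqxx; congr (_ * _)%R.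
by apply: eq_bigr => i _; rewrite nth_rcons ltn_ord.
Qed.

Local Lemma tlS A N n : (forall i, (N <= i)%N -> A i = setT) ->
  tl A N n = P (A n) * tl A N n.+1.
Proof.
move=> AN; rewrite /tl; have [nN|Nn] := ltnP n N; first by rewrite big_ltn.
by rewrite !big_geq//= ?mule1 ?AN// ?probability_setT// ltnW.
Qed.

(* (hd A s) * (tl A N (size s)) is the conditional probability of the box A given
   that the path starts with s; it is a martingale in s. *)
Local Lemma int_val_rcons A N s : (forall i, measurable (A i)) ->
    (forall i, (N <= i)%N -> A i = setT) ->
  \int[P]_x ((hd A (rcons s x))%:E * tl A N (size (rcons s x))) =
  (hd A s)%:E * tl A N (size s).
Proof.
move=> mA AN.
under eq_integral => x _.
  rewrite hd_rcons size_rcons EFinM muleAC.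
  over. 
rewrite ge0_integralZl//. 
- by rewrite integral_indic// setIT [tl A N (size s)]tlS// -muleA [X in _ * X]muleC.
- by apply/measurable_EFinP; exact: measurable_indic.
- by rewrite mule_ge0// lee_fin.
Qed.

Local Lemma measurable_val_rcons A N s : (forall i, measurable (A i)) ->
  measurable_fun setT
    (fun x => (hd A (rcons s x))%:E * tl A N (size (rcons s x))).
Proof.
move=> mA.
under eq_fun do rewrite hd_rcons size_rcons EFinM.
apply: emeasurable_funM => //.
by apply: emeasurable_funM => //; apply/measurable_EFinP; exact: measurable_indic.
Qed.

Local Lemma hd_mkseq A w n : box A w -> hd A (mkseq w n) = 1%R.
Proof.
move=> Aw; rewrite /hd big1// => i _.
rewrite indicE nth_mkseq ?mem_set//.
by case: i => /= m; rewrite size_mkseq.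
Qed.

Local Lemma hd_mkseqN A w n N : (forall i, (N <= i)%N -> A i = setT) -> (N <= n)%N ->
  ~ box A w -> hd A (mkseq w n) = 0%R.
Proof.
move=> AN Nn /existsNP[i Ai]; have iN : (i < N)%N.
  by rewrite ltnNge; apply/negP => /AN Ait; apply: Ai; rewrite Ait.
have ins : (i < size (mkseq w n))%N by rewrite size_mkseq (leq_trans iN).
rewrite /hd (bigD1 (Ordinal ins))//= indicE nth_mkseq ?(leq_trans iN)//.
by rewrite memNset// mul0r.
Qed.

Let val A N s := (hd A s)%:E * tl A N (size s).

Local Lemma val_ge0 A N s : 0 <= val A N s.
Proof. by rewrite mule_ge0// lee_fin. Qed.

#[local] Hint Resolve val_ge0 : core.

Local Lemma val_mkseq A N w n : (forall i, (N <= i)%N -> A i = setT) -> (N <= n)%N ->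
  val A N (mkseq w n) = (\1_(box A) w)%:E.
Proof.
move=> AN Nn; rewrite /val indicE /tl size_mkseq big_geq// mule1.
have [Aw|Aw] := boolP (w \in box A); first by rewrite hd_mkseq// -inE.
by rewrite (hd_mkseqN AN)// => ?; rewrite mem_set in Aw.
Qed.

(* Key comparison: if the box measures violated the inequality, a path along which
   the conditional probabilities keep violating it could be built one coordinate
   at a time, contradicting the pointwise comparison of indicators. *)
Local Lemma compare (A B : nat -> nat -> set T) (N M : nat -> nat) K :
  (forall k i, measurable (A k i)) -> (forall k i, measurable (B k i)) ->
  (forall k i, (N k <= i)%N -> A k i = setT) ->
  (forall k i, (M k <= i)%N -> B k i = setT) ->
  (forall w, exists K', \sum_(k < K) (\1_(box (B k)) w)%:E <=
                       \sum_(k < K') (\1_(box (A k)) w)%:E :> \bar R) ->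
  \sum_(k < K) tl (B k) (M k) 0 <= \sum_(0 <= k <oo) tl (A k) (N k) 0.
Proof.
move=> mA mB AN BM AB; rewrite leNgt; apply/negP => ltAB.
pose Q s := \sum_(0 <= k <oo) val (A k) (N k) s < \sum_(k < K) val (B k) (M k) s.
have Q0 : Q [::].
  rewrite /Q /val /hd /=.
  under eq_eseriesr do rewrite big_ord0 mul1e.
  by under eq_bigr do rewrite big_ord0 mul1e.
have QS s : exists x, Q s -> Q (rcons s x).
  apply: contrapT => /forallNP Qx.
  have [Qs _] := (not_implyP _ _).1 (Qx point).
  have {}Qx x : \sum_(k < K) val (B k) (M k) (rcons s x) <=
      \sum_(0 <= k <oo) val (A k) (N k) (rcons s x).
    by have [_ /negP] := (not_implyP _ _).1 (Qx x); rewrite -leNgt.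
  move: Qs; rewrite /Q; apply/negP; rewrite -leNgt.
  have -> : \sum_(k < K) val (B k) (M k) s =
      \int[P]_x \sum_(k < K) val (B k) (M k) (rcons s x).
    rewrite ge0_integral_sum//.
    - by apply: eq_bigr => k _; rewrite int_val_rcons//; exact: BM.
    - by move=> k; exact: measurable_val_rcons.
  have -> : \sum_(0 <= k <oo) val (A k) (N k) s =
      \int[P]_x \sum_(0 <= k <oo) val (A k) (N k) (rcons s x).
    rewrite integral_nneseries//.
    - by apply: eq_eseriesr => k _; rewrite int_val_rcons//; exact: AN.
    - by move=> k; exact: measurable_val_rcons.
  apply: ge0_le_integral => //.
  - by move=> x _; apply: sume_ge0.
  - by apply: emeasurable_sum => k; exact: measurable_val_rcons.
  - by apply: ge0_emeasurable_sum => // k _; exact: measurable_val_rcons.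
have [g Qg] := choice QS.
pose hist := fix h n := if n is m.+1 then rcons (h m) (g (h m)) else [::].
pose w n := g (hist n).
have histE n : hist n = mkseq w n.
  by elim: n => // n IH /=; rewrite mkseqS -IH.
have Qw n : Q (mkseq w n).
  by rewrite -histE; elim: n => // n IH /=; exact: Qg.
have [K' wAB] := AB w.
pose n := (\max_(k < K) M k + \max_(k < K') N k)%N.
have := Qw n; rewrite /Q; apply/negP; rewrite -leNgt.
apply: le_trans (nneseries_lim_ge K' _); last by [].
rewrite big_mkord (eq_bigr (fun k : 'I_K => (\1_(box (B k)) w)%:E)); last first.
  move=> k _; rewrite val_mkseq//; first exact: BM.
  by apply: leq_trans (leq_addr _ _); exact: (leq_bigmax k).
apply: (le_trans wAB); rewrite le_eqVlt; apply/orP; left; apply/eqP.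
apply: eq_bigr => k _; rewrite val_mkseq//; first exact: AN.
by apply: leq_trans (leq_addl _ _); exact: (leq_bigmax k).
Qed.

Local Lemma rep C : exists AN : (nat -> set T) * nat, cylinder C -> is_box C AN.1 AN.2.
Proof.
have [[A [N h]]|nC] := pselect (cylinder C); first by exists (A, N).
by exists (point, 0%N).
Qed.

Let repA C := (projT1 (cid (rep C))).1.
Let repN C := (projT1 (cid (rep C))).2.
Local Lemma repP C : cylinder C -> is_box C (repA C) (repN C).
Proof. by rewrite /repA /repN; case: cid => /= AN. Qed.

(* By boxes_measureE below, the value does not depend on the chosen
   representation of C as a box. *)
Definition boxes_measure (C : set boxes) : \bar R := tl (repA C) (repN C) 0.


Let pad A k : nat -> set T :=
  if k is 0%N then A else fun i => if i == 0%N then set0 else setT.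
Let padN N k : nat := if k is 0%N then N else 1%N.

Local Lemma compare1 A N (B : nat -> nat -> set T) (M : nat -> nat) K :
  (forall i, measurable (A i)) -> (forall i, (N <= i)%N -> A i = setT) ->
  (forall k i, measurable (B k i)) ->
  (forall k i, (M k <= i)%N -> B k i = setT) ->
  (forall w, \sum_(k < K) (\1_(box (B k)) w)%:E <= (\1_(box A) w)%:E :> \bar R) ->
  \sum_(k < K) tl (B k) (M k) 0 <= tl A N 0.
Proof.
move=> mA AN mB BM AB.
have -> : tl A N 0 = \sum_(0 <= k <oo) tl (pad A k) (padN N k) 0.
  rewrite (@nneseries_split _ _ 0 1)//= big_nat1 eseries0 ?adde0// => -[//|i] _ _.
  by rewrite /tl big_nat1 /= measure0.
apply: compare => //.
- by move=> [|k] i //=; case: ifP.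
- by move=> [|k] [|i] //= ?; exact: AN.
- by move=> w; exists 1%N; rewrite big_ord1.
Qed.

Local Lemma boxes_measureE A N C :
  is_box C A N -> boxes_measure C = \prod_(0 <= i < N) P (A i).
Proof.
move=> CA; have [rmA rAN CE] := repP (ex_intro _ A (ex_intro _ N CA)).
have [mA AN CE'] := CA.
have boxE : box A = box (repA C) by rewrite -CE -CE'.
apply/eqP; rewrite eq_le; apply/andP; split.
- have := @compare1 A N (fun=> repA C) (fun=> repN C) 1.
  by rewrite big_ord1; apply => // w; rewrite big_ord1 boxE.
- have := @compare1 (repA C) (repN C) (fun=> A) (fun=> N) 1.
  by rewrite big_ord1; apply => // w; rewrite big_ord1 boxE.
Qed.

Local Lemma boxes_measure0 : boxes_measure set0 = 0.
Proof.
have /boxes_measureE -> : is_box set0 (fun i => if i == 0%N then set0 else setT) 1.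
  by split => [[|i]|[|i]|] //=; rewrite box0.
by rewrite big_nat1 /= measure0.
Qed.

Local Lemma boxes_measure_ge0 C : 0 <= boxes_measure C.
Proof. exact: tl_ge0. Qed.

Local Lemma boxes_measure_semi_sigma_additive : semi_sigma_additive boxes_measure.
Proof.
move=> F mF tF mUF.
have boxF k : box (repA (F k)) = F k by have [_ _ <-] := repP (mF k).
have boxU : box (repA (\bigcup_n F n)) = \bigcup_n F n by have [_ _ <-] := repP mUF.
suff -> : boxes_measure (\bigcup_n F n) = \sum_(0 <= n <oo) boxes_measure (F n).
  by apply: is_cvg_nneseries => n _ _; exact: boxes_measure_ge0.
apply/eqP; rewrite eq_le; apply/andP; split.
- have := @compare (repA \o F) (fun=> repA (\bigcup_n F n))
    (repN \o F) (fun=> repN (\bigcup_n F n)) 1.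
  rewrite big_ord1; apply => //.
  + by move=> k; have [] := repP (mF k).
  + by have [] := repP mUF.
  + by move=> k; have [] := repP (mF k).
  + by have [] := repP mUF.
  + move=> w; have [[k _ Fkw]|nF] := pselect ((\bigcup_n F n) w).
      exists k.+1; rewrite big_ord1 boxU indicE mem_set; last by exists k.
      rewrite big_ord_recr/= boxF [in X in _ + X]indicE mem_set//.
      by rewrite leeDr// sume_ge0// => i _; rewrite lee_fin indicE.
    by exists 0%N; rewrite big_ord0 big_ord1 boxU indicE memNset.
- apply: lime_le.
    by apply: is_cvg_nneseries => n _ _; exact: boxes_measure_ge0.
  apply: nearW => K; rewrite big_mkord.
  apply: (@compare1 (repA (\bigcup_n F n)) _ (repA \o F) (repN \o F)).
  + by have [] := repP mUF.
  + by have [] := repP mUF.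
  + by move=> k; have [] := repP (mF k).
  + by move=> k; have [] := repP (mF k).
  + move=> w; rewrite boxU.
    have [[k _]|nk] := pselect (exists2 k : 'I_K, True & F k w).
      move=> Fkw; rewrite (bigD1 k)//= big1 => [|j jk]; last first.
        rewrite boxF indicE memNset// => Fjw; move/negP: jk; apply.
        by apply/eqP/val_inj; apply: tF => //; exists w.
      by rewrite adde0 boxF !indicE !mem_set//; exists k.
    rewrite big1; first by rewrite lee_fin indicE.
    move=> k _; rewrite boxF indicE memNset// => Fkw.
    by apply: nk; exists k.
Qed.

HB.instance Definition _ := isMeasure.Build _ _ _ boxes_measure
  boxes_measure0 boxes_measure_ge0 boxes_measure_semi_sigma_additive.

Definition path_space : measurableType _ := g_sigma_algebraType cylinder.

Definition iid_measure : set path_space -> \bar R :=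
  measure_extension boxes_measure.

HB.instance Definition _ := isMeasure.Build _ path_space R iid_measure
  (measure0 (measure_extension boxes_measure))
  (measure_ge0 (measure_extension boxes_measure))
  (@measure_semi_sigma_additive _ _ _ (measure_extension boxes_measure)).

Local Lemma iid_measure_is_box A N C :
  is_box C A N -> iid_measure C = \prod_(0 <= i < N) P (A i).
Proof.
move=> CA; rewrite -(boxes_measureE CA).
by apply: measurable_mu_extE; exists A, N.
Qed.

Local Lemma iid_measure_setT : iid_measure setT = 1.
Proof.
rewrite (@iid_measure_is_box (fun=> setT) 0) ?big_geq//.
by split => //; rewrite predeqE.
Qed.

HB.instance Definition _ :=
  Measure_isProbability.Build _ _ _ iid_measure iid_measure_setT.

Lemma iid_measureE n A : (forall i, measurable (A i)) ->
  iid_measure [set w | forall i, (i < n)%N -> A i (w i)] = \prod_(i < n) P (A i).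
Proof.
move=> mA; rewrite (@iid_measure_is_box (fun i => if (i < n)%N then A i else setT) n).
  by rewrite big_mkord; apply: eq_bigr => i _; rewrite ltn_ord.
split.
- by move=> i; case: ifP.
- by move=> i; rewrite leqNgt => /negbTE ->.
- rewrite predeqE => w; split=> [h i|h i ni].
    by case: ifPn => // ni; exact: h.
  by have := h i; rewrite ni.
Qed.

End infinite_product.

Section e_process.
Context d (X : measurableType d) (R : realType).

(* lne is the extended logarithm: lne 0 = -oo and lne +oo = +oo. *)
Definition KL (P Q : probability X R) : \bar R :=
  if `[< P `<< Q >] then
    \int[P]_x lne (Radon_Nikodym (charge_of_finite_measure P) Q x)
  else +oo.

Variable E : X -> \bar R.

(* The coordinate X_n, for n = 1, 2, ..., is the entry of index n.-1 of a path. *)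
Definition coord (n : nat) (w : path_space X) : X := w n.-1.

(* The product is that of \bar R, where 0 * +oo = 0. *)
Definition wealth (t : nat) (w : path_space X) : \bar R :=
  \prod_(1 <= n < t.+1) E (coord n w).

Definition rejection_time (alpha : R) (w : path_space X) : \bar R :=
  ereal_inf [set t%:R%:E | t in
    [set t : nat | (0 < t)%N /\ (1 / alpha)%:E < wealth t w]].

End e_process.

(* Main.v *)
Require Import Defs.
From mathcomp Require Import all_boot all_order all_algebra.
From mathcomp Require Import all_classical all_reals all_analysis measurable_realfun.
From mathcomp Require Import lra.
Import Order.TTheory GRing.Theory Num.Theory.
Local Open Scope classical_set_scope.
Local Open Scope ring_scope.
Local Open Scope ereal_scope.

(* Since the integral of lne E is positive, its negative part is integrable, so
   E > 0 a.s. and lne E dominates a real function L bounded above by some M, still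
   of positive mean mu.  The walk s + sum_(i < n) L (X_i) cannot stay below c
   forever: conditioning on the first step shows that the expected time it spends
   there is at most (c + M - s) / mu (Wald's identity, with overshoot at most M).
   The exponential of the walk started at 0 is a lower bound for the wealth. *)

(** * Coordinates of path space and prepending a coordinate *)

Section path_space_theory.
Context (d : measure_display) (X : measurableType d).

Lemma coord_box (k : nat) (B : set X) : measurable B ->
  is_box [set w : nat -> X | B (w k)] (fun i => if i == k then B else setT) k.+1.
Proof.
move=> mB; split => [i|i ki|].
- by case: ifP.
- by rewrite gtn_eqF.
- rewrite predeqE => w; split => [Bw i|/(_ k)]; last by rewrite eqxx.
  by case: eqP => // ->.
Qed.

Lemma measurable_coord (k : nat) :
  measurable_fun [set: path_space X] (fun w : path_space X => w k : X).
Proof.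
move=> _ B mB; rewrite setTI; apply: sub_sigma_algebra.
by exists (fun i => if i == k then B else setT), k.+1; exact: coord_box.
Qed.

Definition path_cons (xw : X * path_space X) : path_space X :=
  fun n => if n is m.+1 then xw.2 m else xw.1.

Lemma path_cons_box (A : nat -> set X) :
  path_cons @^-1` box A = A 0%N `*` box (fun n => A n.+1).
Proof.
rewrite predeqE => -[x w]; split => [Axw|[/= Ax Aw] [|n]//].
by split => [|n]; [exact: (Axw 0%N)|exact: (Axw n.+1)].
Qed.

Lemma box_tail (A : nat -> set X) N C : is_box C A N ->
  is_box (box (fun n => A n.+1)) (fun n => A n.+1) N.
Proof. by case=> mA AN _; split => // i Ni; rewrite AN// leqW. Qed.

Lemma measurable_path_cons :
  measurable_fun [set: X * path_space X] path_cons.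
Proof.
apply: (@measurability _ _ _ (path_space X) _ _ (@cylinder d X)) => //.
move=> _ [C [A [N CA]] <-]; have [mA AN ->] := CA; rewrite setTI path_cons_box.
apply: measurableX => //; apply: sub_sigma_algebra.
by exists (fun n => A n.+1), N; exact: box_tail CA.
Qed.

Context (R : realType) (P : probability X R).

Lemma iid_measure_boxE (A : nat -> set X) N C : is_box C A N ->
  iid_measure P C = \prod_(i < N) P (A i).
Proof.
move=> [mA AN ->]; rewrite -iid_measureE//; congr iid_measure.
rewrite predeqE => w; split => [Aw i _|Aw i]; first exact: Aw.
by have [/Aw//|Ni] := ltnP i N; rewrite AN.
Qed.

(** Coordinate [k] has law [P], so a [P]-null set pulls back to a null set of paths. *)
Lemma ae_coord (k : nat) (p : X -> Prop) : {ae P, forall x, p x} ->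
  {ae iid_measure P, forall w : path_space X, p (w k)}.
Proof.
move=> [N [mN PN pN]].
exists ([set: path_space X] `&` (fun w : path_space X => w k : X) @^-1` N).
split; [exact: measurable_coord| |by move=> w /= pw; split => //; exact: pN].
rewrite (iid_measure_boxE (fun i => if i == k then N else setT) k.+1).
  by rewrite big_ord_recr/= eqxx PN mule0.
rewrite setTI; exact: coord_box.
Qed.

(** This is conditioning on the first coordinate. The right side is the image under [path_cons] of
    the product of [P] and [iid_measure P]; the two measures agree on boxes, which are stable under
    intersection and generate the sigma-algebra. *)
Lemma iid_measure_path_cons (C : set (path_space X)) : measurable C ->
  iid_measure P C = \int[P]_x iid_measure P (xsection (path_cons @^-1` C) x).
Proof.
pose Q := iid_measure P : probability (path_space X) R.
move=> mC; rewrite -[RHS]/(pushforward (P \x Q) path_cons C).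
have mcons := measurable_path_cons.
pose m := pushforward (P \x Q) path_cons : measure (path_space X) R.
suff /(_ C mC) : forall D, measurable D -> Q D = m mcons D by [].
have mU := @measure_unique _ _ (path_space X) (@cylinder d X) (fun=> setT)
  erefl _ _ _ Q (m mcons).
apply: mU => //.
- exact: Defs.cylinderI.
- by move=> _; exists (fun=> setT), 0%N; split => //; rewrite predeqE.
- by rewrite bigcup_const//; exists 0%N.
- move=> D [A [N DA]]; have [mA AN DE] := DA.
  have -> : m mcons D = P (A 0%N) * Q (box (fun n => A n.+1)).
    rewrite -product_measure1E//.
      by rewrite -[m mcons D]/((P \x Q) (path_cons @^-1` D)) DE path_cons_box.
    by apply: sub_sigma_algebra; exists (fun n => A n.+1), N; exact: box_tail DA.
  rewrite /Q/= (iid_measure_boxE A N.+1)// ?big_ord_recl//=.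
    by rewrite (iid_measure_boxE _ _ _ (box_tail _ _ _ DA)).
  by split => // i Ni; rewrite AN// ltnW.
- by move=> _; apply: (le_lt_trans (probability_le1 Q measurableT)); rewrite ltry.
Qed.

(** * Random walk with positive drift and steps bounded above *)

Section bounded_walk.
Variables (L : X -> R) (M c mu : R).
Hypotheses (mL : measurable_fun [set: X] L) (LM : forall x, (L x <= M)%R).
Hypotheses (intL : P.-integrable [set: X] (EFin \o L)).
Hypotheses (M0 : (0 <= M)%R) (mu0 : (0 < mu)%R).
Hypothesis (muE : \int[P]_x (L x)%:E = mu%:E).

Definition walk (s : R) (n : nat) (w : nat -> X) : R :=
  (s + \sum_(i < n) L (w i))%R.

Lemma measurable_walk s n :
  measurable_fun [set: path_space X] (walk s n : path_space X -> R).
Proof.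
apply: measurable_funD => //; apply: measurable_sum => i.
exact: (measurableT_comp mL (measurable_coord i)).
Qed.

Lemma walk_path_cons s n x w :
  walk s n.+1 (path_cons (x, w)) = walk (s + L x) n w.
Proof. by rewrite /walk big_ord_recl/= addrA. Qed.

(** The constraint begins after the first step, so [walk_below s 0] is the whole space and [s]
    itself is not constrained. *)
Definition walk_below (s : R) (n : nat) : set (path_space X) :=
  [set w : nat -> X | forall k, (k < n)%N -> (walk s k.+1 w <= c)%R].

Lemma measurable_walk_below s n : measurable (walk_below s n).
Proof.
have -> : walk_below s n = \bigcap_(k in `I_n)
    ([set: path_space X] `&`
     (walk s k.+1 : path_space X -> R) @^-1` `]-oo, c]).
  rewrite predeqE => w; split => [ws k /ws|ws k /ws [_]].
    by split => //=; rewrite in_itv.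
  by rewrite /= in_itv.
apply: bigcap_measurableType => k _.
by apply: measurable_walk => //; exact: measurable_itv.
Qed.

(** After a first step [x] the walk starts afresh from [s + L x]; if that value exceeds [c], the
    constraint has already failed. *)
Lemma xsection_walk_below s n x :
  xsection (path_cons @^-1` walk_below s n.+1) x =
  if (s + L x <= c)%R then walk_below (s + L x) n else set0.
Proof.
rewrite xsectionE predeqE => w /=; split => [h|].
  have := h 0%N; rewrite walk_path_cons {1}/walk big_ord0 addr0 => /(_ isT) ->.
  by move=> k kn; have := h k.+1; rewrite walk_path_cons; exact.
case: ifPn => // sc h [|k] kn; rewrite walk_path_cons.
  by rewrite /walk big_ord0 addr0.
exact: h.
Qed.

(** Induction on [n] for all [s]: the term [k = 0] is 1, and the induction hypothesis at [s + L x]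
    bounds the others. The bound is affine in the starting point, so one step lowers it by exactly 1
    on average. *)
Lemma sum_walk_below n s : (s <= c)%R ->
  \sum_(k < n) iid_measure P (walk_below s k) <= ((c + M - s) / mu)%:E.
Proof.
pose Q := iid_measure P : probability (path_space X) R.
elim: n s => [|n IH] s sc.
  by rewrite big_ord0 lee_fin divr_ge0 ?(ltW mu0)//; move: M0; lra.
have mC k : measurable (path_cons @^-1` walk_below s k).
  rewrite -[X in measurable X]setTI.
  by apply: measurable_path_cons => //; exact: measurable_walk_below.
rewrite big_ord_recl.
have -> : walk_below s (@ord0 n) = setT by rewrite predeqE => w; split.
rewrite [X in X + _](@probability_setT _ _ _ Q).
rewrite (eq_bigr _ (fun (k : 'I_n) _ =>
  iid_measure_path_cons _ (measurable_walk_below s k.+1))).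
rewrite -ge0_integral_sum//; last first.
  by move=> k; exact: (measurable_fun_xsection Q (mC k.+1)).
have intK (k : R) : P.-integrable setT (EFin \o cst k).
  exact: finite_measure_integrable_cst.
(* [mu^-1 * L] has integral 1, which isolates the contribution of the term [k = 0]. *)
have -> : ((c + M - s) / mu)%:E =
    1 + \int[P]_x ((c + M - s) / mu - mu^-1 * L x)%:E.
  have intmu : P.-integrable setT (fun x => (mu^-1 * L x)%:E).
    by under eq_fun do rewrite EFinM; exact: integrableZl.
  under eq_integral do rewrite EFinB.
  rewrite integralB_EFin//; last exact: intK.
  rewrite integral_cst//= probability_setT mule1.
  under [X in _ + (_ - X)]eq_integral do rewrite EFinM.
  rewrite integralZl// muE -!EFinM -EFinB -EFinD mulVf ?gt_eqF//.
  by rewrite addrCA subrr addr0.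
rewrite leeD2l//; apply: ge0_le_integral => //.
- by move=> x _; apply: sume_ge0.
- apply: emeasurable_sum => k; exact: (measurable_fun_xsection Q (mC k.+1)).
- apply/measurable_EFinP; apply: measurable_funB => //.
  exact: measurable_funM.
- move=> x _; rewrite (eq_bigr _ (fun (k : 'I_n) _ =>
    congr1 (iid_measure P) (xsection_walk_below s k x))).
  have -> : ((c + M - s) / mu - mu^-1 * L x = (c + M - (s + L x)) / mu)%R.
    by rewrite mulrC -mulrBr mulrC opprD addrA.
  (* Past [c] the sections are empty, and [s <= c] with [L x <= M] keeps [c + M - (s + L x)]
     nonnegative; this is why [M] enters the bound. *)
  have [sLc|_] := leP (s + L x)%R c; first exact: IH.
  rewrite big1 ?lee_fin => [|k _]; last by rewrite measure0.
  by rewrite divr_ge0 ?(ltW mu0)//; move: (LM x) sc; lra.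
Qed.

(** The intersection lies in each [walk_below s k], so [n] times its measure stays below a bound
    independent of [n]. *)
Lemma walk_below_null s : (s <= c)%R ->
  iid_measure P (\bigcap_n walk_below s n) = 0.
Proof.
pose Q := iid_measure P : probability (path_space X) R.
move=> sc; have mB := measurable_walk_below s.
have mI : measurable (\bigcap_n walk_below s n) by exact: bigcap_measurableType.
have nI n : n%:R%:E * Q (\bigcap_k walk_below s k) <= ((c + M - s) / mu)%:E.
  apply: le_trans (sum_walk_below n _ sc).
  have -> : n%:R%:E * Q (\bigcap_k walk_below s k) =
      \sum_(k < n) Q (\bigcap_k walk_below s k).
    by rewrite mule_natl sumr_const card_ord.
  apply: lee_sum => k _; apply: (le_measure Q); rewrite ?inE//.
  exact: bigcap_inf.
apply/eqP; rewrite eq_le measure_ge0 andbT leNgt; apply/negP => Q0.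
have /fineK Qfin : Q (\bigcap_k walk_below s k) \is a fin_num.
  exact: fin_num_measure.
have r0 : (0 < fine (Q (\bigcap_k walk_below s k)))%R.
  by rewrite -lte_fin Qfin.
(* An integer above the bound divided by the measure of the intersection contradicts [nI]. *)
move: (nI (Num.bound ((c + M - s) / mu /
  fine (Q (\bigcap_k walk_below s k))))).
apply/negP; rewrite -ltNge -Qfin -EFinM lte_fin -ltr_pdivrMr//=.
apply: archi_boundP; rewrite divr_ge0 ?(ltW r0)// divr_ge0 ?(ltW mu0)//.
by move: M0; lra.
Qed.
End bounded_walk.
End path_space_theory.

(** * The extended logarithm *)

Lemma lee_lneE (R : realType) (r : R) (x : \bar R) :
  (r%:E <= lne x) = ((expR r)%:E <= x).
Proof.
case: x => [y| |] //=; rewrite ?leey//; case: ifPn => [y0|].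
  (* For [y <= 0] the logarithm is [-oo], and [expR r > 0] makes the right side false as well. *)
  rewrite leNgt ltNye/= lee_fin; apply/esym/negbTE.
  by rewrite -ltNge (le_lt_trans y0)// expR_gt0.
by rewrite -ltNge => y0; rewrite !lee_fin -ler_expR lnK.
Qed.

(** By [lee_lneE] closed upper rays pull back to closed upper rays, and these generate the
    sigma-algebra of [\bar R]. *)
Lemma measurable_lne (R : realType) : measurable_fun [set: \bar R] (@lne R).
Proof.
apply: (measurability _ (ErealGenCInfty.measurableE R)) => // _ [_ [r ->] <-].
rewrite setTI (_ : _ @^-1` _ = `[(expR r)%:E, +oo[%classic).
  exact: emeasurable_itv.
by rewrite predeqE => x /=; rewrite !in_itv/= !andbT lee_lneE.
Qed.

(** * Truncating a function of positive mean *)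

Section truncation.
Context (d : measure_display) (X : measurableType d) (R : realType).
Variables (P : probability X R) (f : X -> \bar R).
Hypotheses (mf : measurable_fun [set: X] f) (f0 : 0 < \int[P]_x f x).

(** In [\bar R] the sum [+oo - oo] is [-oo], so an infinite integral of [f^\-] would contradict [f0]
    whatever the positive part. *)
Lemma integral_funeneg_lty : \int[P]_x f^\- x < +oo.
Proof.
move: f0; rewrite integralE ltey; apply: contraTneq => ->.
by rewrite addeNy -leNgt leNye.
Qed.

Lemma integrable_negpart : P.-integrable [set: X] f^\-.
Proof.
apply/integrableP; split; first exact: measurable_funeneg.
under eq_integral do rewrite gee0_abs//.
exact: integral_funeneg_lty.
Qed.

Lemma ae_neqNy : {ae P, forall x, f x != -oo}.
Proof.
have := integrable_ae measurableT integrable_negpart.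
apply: filterS => x /(_ Logic.I); apply: contraTN => /eqP fx.
by rewrite funenegE fx.
Qed.

(** Only the positive part is capped: [L] is [min(f^\+, n) - f^\-], with [n] so large that the mean
    remains positive. *)
Lemma truncated_minorant : exists (L : X -> R) (M mu : R),
  [/\ measurable_fun [set: X] L, (forall x, (L x <= M)%R),
      P.-integrable [set: X] (EFin \o L), (0 <= M)%R &
   [/\ (0 < mu)%R, \int[P]_x (L x)%:E = mu%:E &
      forall x, f x != -oo -> (L x)%:E <= f x]].
Proof.
pose g (n : nat) x := mine (f^\+ x) n%:R%:E.
have g0 n x : 0 <= g n x by rewrite /g le_min funepos_ge0 lee_fin ler0n.
have gfin n x : g n x \is a fin_num.
  by rewrite ge0_fin_numE// /g gt_min ltry orbT.
have mg n : measurable_fun [set: X] (g n).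
  by apply: measurable_mine => //; exact: measurable_funepos.
have ndg x : {homo g^~ x : n m / (n <= m)%N >-> n <= m}.
  by move=> n m nm; rewrite le_min !ge_min lexx/= lee_fin ler_nat nm orbT.
have gE x : limn (g^~ x) = f^\+ x.
  apply/cvg_lim => //; rewrite /g; case: (f^\+ x) (funepos_ge0 f x) => //= [r r0|_].
    apply: cvg_near_cst; near=> n; apply/min_idPl; rewrite lee_fin.
    by near: n; exact: nbhs_infty_ger.
  by under eq_cvg do rewrite minye; apply/cvgenyP.
(* By monotone convergence the integrals of [g n] tend to that of [f^\+], which exceeds that of
   [f^\-] by [f0]. *)
have [n gn] : exists n, \int[P]_x f^\- x < \int[P]_x g n x.
  apply: contrapT => /forallNP gn.
  have : \int[P]_x f^\+ x <= \int[P]_x f^\- x.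
    under eq_integral do rewrite -gE.
    rewrite monotone_convergence//; apply: lime_le.
      apply: ereal_nondecreasing_is_cvgn => n m nm.
      by apply: ge0_le_integral => // x _; exact: ndg.
    by apply: nearW => n; rewrite leNgt; apply/negP.
  by apply/negP; rewrite -ltNge -sube_gt0 -integralE.
(* [fine] sends [+oo] to 0, so [b] is 0 where [f] is [-oo]; there [L] is not below [f], hence the
   restriction in the last clause. *)
pose a x := fine (g n x); pose b x := fine (f^\- x).
have a0 x : (0 <= a x)%R by rewrite fine_ge0.
have b0 x : (0 <= b x)%R by rewrite fine_ge0.
have an x : (a x <= n%:R)%R.
  by rewrite -lee_fin fineK// ge_min lexx orbT.
have ma : measurable_fun [set: X] a by exact: measurableT_comp.
have mb : measurable_fun [set: X] b.
  by apply: measurableT_comp => //; exact: measurable_funeneg.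
have inta : P.-integrable [set: X] (EFin \o a).
  apply: (le_integrable measurableT _ _
    (finite_measure_integrable_cst P n%:R measurableT)).
    exact/measurable_EFinP.
  by move=> x _ /=; rewrite lee_fin !ger0_norm.
have bf x : (b x)%:E <= f^\- x.
  by rewrite /b; case: (f^\- x) (funeneg_ge0 f x) => //= *; rewrite leey.
have intb : P.-integrable [set: X] (EFin \o b).
  apply: (le_integrable measurableT _ _ integrable_negpart).
    exact/measurable_EFinP.
  by move=> x _; rewrite !gee0_abs//= lee_fin.
have intL : P.-integrable [set: X] (EFin \o (a \- b)%R).
  exact: (integrableB measurableT inta intb).
exists (a \- b)%R, n%:R, (fine (\int[P]_x ((a \- b)%R x)%:E)).
rewrite fineK ?integrable_fin_num//; split => //.
- exact: measurable_funB.
- by move=> x /=; rewrite lerBlDr (le_trans (an x))// lerDl.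
split => //.
- rewrite fine_gt0// integrable_lty// andbT.
  under eq_integral do rewrite EFinB.
  rewrite integralB_EFin// sube_gt0.
  apply: (@le_lt_trans _ _ (\int[P]_x f^\- x)).
    apply: ge0_le_integral => //.
    - by move=> x _; rewrite lee_fin.
    - exact/measurable_EFinP.
    - exact: measurable_funeneg.
  by under [ltRHS]eq_integral do rewrite fineK//.
- move=> x fx; rewrite [f in leRHS]funeposneg EFinB.
  apply: leeB; first by rewrite fineK// ge_min lexx.
  rewrite fineK// ge0_fin_numE// funenegE gt_max ltry andbT.
  by rewrite lteNl ltNye.
Unshelve. all: by end_near.
Qed.
End truncation.

(** * From the walk to the wealth *)

Lemma wealth_ge_walk (d : measure_display) (X : measurableType d)
    (R : realType) (E : X -> \bar R) (L : X -> R) (w : nat -> X) n :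
  (forall k, (L (w k))%:E <= lne (E (w k))) ->
  (expR (walk d X R L 0%R n w))%:E <= wealth E n w.
Proof.
move=> LE; elim: n => [|n IH].
  by rewrite /walk /wealth big_ord0 add0r expR0 big_geq.
(* [coord] lowers indices by one, so the last factor of the wealth is [E (w n)], matching the last
   step of the walk. *)
rewrite /walk /wealth big_ord_recr/= big_nat_recr//= addrA expRD EFinM.
by apply: lee_pmul; rewrite ?lee_fin ?expR_ge0// -lee_lneE; exact: LE.
Qed.

Theorem proposition3p10 (d : measure_display) (X : measurableType d)
    (R : realType) (P0 P1 : probability X R) (E : X -> \bar R) :
  P1 `<< P0 ->
  KL P1 P0 < +oo ->
  measurable_fun [set: X] E ->
  (forall x, 0 <= E x) ->
  \int[P0]_x E x <= 1 ->
  0 < \int[P1]_x lne (E x) ->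
  forall alpha : R, (0 < alpha < 1)%R ->
  {ae iid_measure P1, forall w, rejection_time E alpha w < +oo}.
Proof.
move=> _ _ mE _ _ drift alpha /andP[alpha0 alpha1].
have mlE : measurable_fun [set: X] (fun x => lne (E x)).
  by apply: measurableT_comp mE; exact: measurable_lne.
have [L [M [mu [mL LM intL M0 [mu0 muE LE]]]]] :=
  truncated_minorant _ _ _ P1 _ mlE drift.
(* The walk passes [c] exactly when its exponential passes [1 / alpha]; as [alpha < 1], its starting
   point 0 is at most [c]. *)
pose c := ln (1 / alpha)%R.
have a1 : (1 <= 1 / alpha)%R by rewrite ler_pdivlMr// mul1r ltW.
have c0 : (0 <= c)%R by rewrite ln_ge0.
have null := walk_below_null _ _ _ P1 L M c mu mL LM intL M0 mu0 muE 0%R c0.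
have good : {ae iid_measure P1, forall w : path_space X,
    forall k, lne (E (w k)) != -oo}.
  apply/ae_foralln => k.
  exact: (ae_coord _ _ _ P1 k (fun x => lne (E x) != -oo)
    (ae_neqNy _ _ _ P1 _ mlE drift)).
have unbounded : {ae iid_measure P1, forall w : path_space X,
    ~ (\bigcap_n walk_below d X R L c 0%R n) w}.
  exists (\bigcap_n walk_below d X R L c 0%R n); split => //.
    by apply: bigcap_measurableType => n _; exact: measurable_walk_below.
  by move=> w /contrapT.
apply: filterS2 good unbounded => w wE /existsNP[n /not_implyP[_]].
move=> /existsNP[k /not_implyP[_ /negP]]; rewrite -ltNge => ck.
(* The walk is above [c] after [k.+1] steps, a positive number of steps as the rejection time
   demands. *)
have : rejection_time E alpha w <= k.+1%:R%:E.
  apply: ereal_inf_lbound; exists k.+1 => //; split => //.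
  apply: lt_le_trans (wealth_ge_walk _ _ _ _ L w k.+1 _).
    rewrite lte_fin -[ltLHS]lnK ?ltr_expR// posrE.
    exact: lt_le_trans a1.
  by move=> i; exact: LE.
by move=> /le_lt_trans; apply; rewrite ltry.
Qed.
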